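(* Let $[a,b]$ be a finite interval and let $\{f_n\}_{n\in\mathbb N}$ be a sequence of nonnegative summable functions on $[a,b]$. Assume that there exists a nonnegative summable function $f$ on $[a,b]$ such that for all $x\in[a,b]$ $$\lim_{n\to\infty}\int_a^x f_n(t)\,dt=\int_a^x f(t)\,dt .$$ Assume also that there is a positive function $g\in L_p[a,b]$ ($p\ge 1$) such that $f_n(t)\le g(t)$ for all $n\in\mathbb N$ and almost all $t\in[a,b]$. Then $f\in L_p[a,b]$.
   Context: $L_p[a,b]$ is the usual Lebesgue space on $[a,b]$ with respect to Lebesgue measure; ''summable'' means Lebesgue integrable. *)

(* Defs.v *)
From mathcomp Require Import all_boot all_order all_algebra.
From mathcomp Require Import all_classical all_reals all_analysis.
Import Order.TTheory GRing.Theory Num.Theory.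
Import numFieldNormedType.Exports.

Set Implicit Arguments.
Unset Strict Implicit.
Unset Printing Implicit Defensive.

Local Open Scope classical_set_scope.
Local Open Scope ring_scope.

(* The completed measure lives on the sigma-algebra of all Lebesgue-measurable
   sets, whereas [lebesgue_measure] only knows the Borel ones; measurability
   and integrability below are therefore in Lebesgue's sense. *)
Notation leb R := (@completed_lebesgue_measure R).

Definition summable_on (R : realType) (a b : R) (f : R -> R) : Prop :=
  (leb R).-integrable `[a, b] (EFin \o f).

(* A function on [a, b] is a total function of which only the values on [a, b]
   matter: it is extended by zero, so that the norm that [Lfun] requires to be
   finite is the one of [f] over [a, b]. *)
Definition Lp_on (R : realType) (p a b : R) (f : R -> R) : Prop :=
  patch (cst 0) `[a, b] f \in Lfun (leb R) p%:E.

(* Main.v *)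
Require Import Defs.
From mathcomp Require Import all_boot all_order all_algebra.
From mathcomp Require Import all_classical all_reals all_analysis.
From mathcomp Require Import measurable_realfun.
Import Order.TTheory GRing.Theory Num.Theory.
Import numFieldNormedType.Exports.

(** The idea is that [f <= g] almost everywhere on [[a, b]], so that
    [f ^ p <= g ^ p] almost everywhere and the integrability of [g ^ p] passes
    to [f ^ p].

    Since [[a, b]] has finite measure and [p >= 1], [g <= 1 + g ^ p] shows that
    [g] is summable ([integrable_of_powR]).  Subtracting the convergence
    hypotheses at two points [x <= y] gives convergence of the integrals of [fn n] over
    []x, y]] ([cvg_integral_itvoc]); each of them is at most the integral of
    [g], hence the integral of [f] over any interval of [[a, b]] is at most the
    integral of [g].

    It remains to pass from intervals to a pointwise comparison
    ([ae_le_of_integral_itv]).  The inequality of integrals extends from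
    intervals to open sets, which are countable disjoint unions of intervals
    ([le_integral_open]), and then to Borel sets by outer regularity of the
    Lebesgue measure and absolute continuity of the integral of [g]
    ([le_integral_borel]).  The set where [g < f] is a Borel set up to a null
    set, and on that Borel set the integral of the positive function [f - g] is
    at most zero, so the set is null ([ae_le_of_integral]). *)

Local Open Scope classical_set_scope.
Local Open Scope ring_scope.

(** * Borel sets and the completed Lebesgue measure *)

(** The real line with the sigma-algebra of Lebesgue-measurable sets, which is
    the domain of [leb R]; inference on [R] itself would find the Borel sets. *)
Notation lebT R := (caratheodory_type (wlength (@idfun R))^*%mu).

Lemma completed_measurable (R : realType) (A : set R) :
  measurable A ->
  (wlength (@idfun R))^*%mu.-cara.-measurable A.
Proof. exact: sub_caratheodory. Qed.

Lemma completed_measurable_itv (R : realType) (i : interval R) :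
  (wlength (@idfun R))^*%mu.-cara.-measurable [set` i].
Proof. by apply: completed_measurable; exact: measurable_itv. Qed.

Lemma completed_measureE (R : realType) (A : set R) :
  leb R A = lebesgue_measure A.
Proof. by []. Qed.

(** Endpoints are null, so every bounded interval can be put in the form
    []x, y]], the one that arises from differences of integrals over [[a, x]]. *)
Lemma ge0_integral_itv (R : realType) (x y : R) (c d : bool)
    (F : R -> \bar R) :
  @measurable_fun _ _ (lebT R) _ setT F ->
  (forall t, 0 <= F t)%E ->
  (\int[leb R]_(t in [set` Interval (BSide c x) (BSide d y)]) F t =
   \int[leb R]_(t in `]x, y]) F t)%E.
Proof.
move=> mF F0.
have m2 : (wlength (@idfun R))^*%mu.-cara.-measurable [set x; y].
  by apply: completed_measurable; exact: measurableU.
have m0 : leb R [set x; y] = 0%E.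
  rewrite completed_measureE; apply/eqP; rewrite -measure_le0.
  by rewrite (le_trans (measureU2 _ _ _))//= !lebesgue_measure_set1 adde0.
rewrite (ge0_negligible_integral m2)//=; last 2 first.
- exact: completed_measurable_itv.
- exact: measurable_funTS.
rewrite [RHS](ge0_negligible_integral m2)//=; last 2 first.
- exact: completed_measurable_itv.
- exact: measurable_funTS.
congr integral; apply/seteqP; split => t /= [+ /not_orP[tx ty]].
- move=> h; split; last by apply/not_orP.
  move: h; rewrite !in_itv/= => /andP[h1 h2]; apply/andP; split.
    by rewrite lt_neqAle eq_sym (introN eqP tx) /=; case: c h1 => // /ltW.
  by case: d h2 => // /ltW.
- move=> h; split; last by apply/not_orP.
  move: h; rewrite !in_itv/= => /andP[h1 h2]; apply/andP; split.
    by case: c; rewrite /= ?ltW.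
  by case: d; rewrite //= lt_neqAle (introN eqP ty) h2.
Qed.

(** * From intervals to almost every point *)

(** An open set is a countable disjoint union of open intervals, over which
    integrals of nonnegative functions add up. *)
Lemma le_integral_open (R : realType) (F G : R -> \bar R) :
  @measurable_fun _ _ (lebT R) _ setT F ->
  @measurable_fun _ _ (lebT R) _ setT G ->
  (forall t, 0 <= F t)%E -> (forall t, 0 <= G t)%E ->
  (forall J, is_interval J ->
     \int[leb R]_(t in J) F t <= \int[leb R]_(t in J) G t)%E ->
  forall U, open U -> (\int[leb R]_(t in U) F t <= \int[leb R]_(t in U) G t)%E.
Proof.
move=> mF mG F0 G0 FG U oU.
rewrite (open_disjoint_itv_bigcup oU).
have mI k : (wlength (@idfun R))^*%mu.-cara.-measurable (open_disjoint_itv oU k).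
  apply: completed_measurable; apply: open_measurable.
  exact: open_disjoint_itv_open.
rewrite !ge0_integral_bigcup//=; do ?exact: measurable_funTS;
  do ?exact: open_disjoint_itv_trivIset.
apply: lee_nneseries => k *; first exact: integral_ge0.
apply: FG; exact: open_disjoint_itv_is_interval.
Qed.

(** Outer regularity encloses [X] in an open [U] with [U `\` X] as small as
    desired; absolute continuity then makes the integral of [G] over [U `\` X]
    smaller than [e], whence the integral of [F] over [X] is at most that of [G]
    over [X] plus [e]. *)
Lemma le_integral_borel (R : realType) (F G : R -> R) :
  @measurable_fun _ _ (lebT R) _ setT F ->
  (leb R).-integrable setT (EFin \o G) ->
  (forall t, 0 <= F t) -> (forall t, 0 <= G t) ->
  (forall U, open U ->
     \int[leb R]_(t in U) (F t)%:E <= \int[leb R]_(t in U) (G t)%:E)%E ->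
  forall X : set R, measurable X -> (lebesgue_measure X < +oo)%E ->
  (\int[leb R]_(t in X) (F t)%:E <= \int[leb R]_(t in X) (G t)%:E)%E.
Proof.
move=> mF iG F0 G0 FG X mX Xfin.
have mG := measurable_int _ iG.
apply/lee_addgt0Pr => e e0.
have [d [d0 small]] := @integral_normr_continuous _ _ _ (leb R) G iG e e0.
have [U [oU XU UX]] := lebesgue_regularity_outer mX Xfin d0.
have mU : measurable U by exact: open_measurable.
have mUX : measurable (U `\` X) by exact: measurableD.
have cX := completed_measurable _ _ mX.
have cU := completed_measurable _ _ mU.
have cUX := completed_measurable _ _ mUX.
have iUX : (leb R).-integrable (U `\` X) (EFin \o G) by exact: integrableS iG.
apply: (@le_trans _ _ (\int[leb R]_(t in U) (F t)%:E)%E).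
  apply: (ge0_subset_integral (leb R) cX cU).
  - by apply: measurable_funTS; exact/measurable_EFinP.
  - by move=> *; rewrite lee_fin.
  - exact: XU.
apply: (le_trans (FG _ oU)).
rewrite -(setDUK XU) (ge0_integral_setU (leb R) cX cUX); last 3 first.
- exact: measurable_funTS.
- by move=> *; rewrite lee_fin.
- by apply/disj_setPRL => x [_ ?].
rewrite leeD2l//.
have /ltW := small _ cUX UX.
rewrite -lee_fin; apply: le_trans.
under [in leRHS]eq_Rintegral do rewrite ger0_norm//.
by rewrite /Rintegral fineK//; exact: integrable_fin_num.
Qed.

(** Testing the hypothesis on the set where [G < F] forces it to be null.  This
    set is only Lebesgue-measurable, and is replaced by a Borel set that differs
    from it by a null set. *)
Lemma ae_le_of_integral (R : realType) (a b : R) (F G : R -> R) :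
  (leb R).-integrable setT (EFin \o F) ->
  (leb R).-integrable setT (EFin \o G) ->
  (forall X : set R, measurable X -> (lebesgue_measure X < +oo)%E ->
    (\int[leb R]_(t in X) (F t)%:E <= \int[leb R]_(t in X) (G t)%:E)%E) ->
  {ae leb R, forall t, t \in `[a, b] -> F t <= G t}.
Proof.
move=> iF iG FG.
have mF : @measurable_fun _ _ (lebT R) _ setT F.
  by apply/measurable_EFinP; exact: measurable_int iF.
have mG : @measurable_fun _ _ (lebT R) _ setT G.
  by apply/measurable_EFinP; exact: measurable_int iG.
pose E := `[a, b] `&` [set t | G t < F t].
have mE : (wlength (@idfun R))^*%mu.-cara.-measurable E.
  apply: measurableI; first exact: completed_measurable_itv.
  have := measurable_fun_ltr mG mF measurableT (Y := [set true]) Logic.I.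
  by rewrite setTI.
move: (mE); rewrite -completed_caratheodory_measurable.
rewrite g_sigma_completed_algebra_genE => -[X mX [N [B [mB B0 NB]] XNE]].
have XE : X `<=` E by rewrite -XNE; exact: subsetUl.
have cX := completed_measurable _ _ mX.
have Xfin : (lebesgue_measure X < +oo)%E.
  apply: (@le_lt_trans _ _ (lebesgue_measure `[a, b])).
    by apply: le_measure; rewrite ?inE// => x /XE[].
  by rewrite lebesgue_measure_itv/=; case: ifP; rewrite -?EFinB ltry.
have iFX : (leb R).-integrable X (EFin \o F) by exact: integrableS iF.
have iGX : (leb R).-integrable X (EFin \o G) by exact: integrableS iG.
(* The integrand is positive on [X], so its integral is nonnegative, while the
   hypothesis on [X] makes it nonpositive. *)
have int0 : (\int[leb R]_(t in X) `|(F t)%:E - (G t)%:E|%E = 0)%E.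
  transitivity (\int[leb R]_(t in X) ((F t)%:E - (G t)%:E))%E.
    apply: eq_integral => x; rewrite inE => /XE[_ /= h].
    by rewrite ger0_norm// subr_ge0 ltW.
  apply/eqP; rewrite eq_le; apply/andP; split; last first.
    apply: integral_ge0 => x /XE[_ /= h].
    by rewrite lee_fin subr_ge0 ltW.
  rewrite integralB//= leeBlDr ?add0e ?FG//.
  exact: (integrable_fin_num cX iGX).
have X0 : (leb R).-negligible X.
  have /ae_eq_integral_abs : @measurable_fun _ _ (lebT R) _ X
      (fun t => (F t)%:E - (G t)%:E)%E.
    by have /measurable_int := integrableB cX iFX iGX.
  move=> /(_ (leb R) cX)[/(_ int0) + _].
  apply: negligibleS => x Xx /= /(_ Xx) /eqP.
  have [_ /= h] := XE _ Xx.
  by rewrite eqe subr_eq0 => /eqP FGx; move: h; rewrite FGx ltxx.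
have cB := completed_measurable _ _ mB.
have N0 : (leb R).-negligible N by exists B; split.
apply: negligibleS (negligibleU X0 N0).
rewrite XNE => x /= /not_implyP[xab /negP]; rewrite -ltNge => ?.
by split.
Qed.

(** The restrictions of [f] and [g] to [[a, b]], extended by zero, reduce the
    integral over an arbitrary interval [J] to one over [J `&` [a, b]], which is
    bounded and hence an interval with real endpoints. *)
Lemma ae_le_of_integral_itv (R : realType) (a b : R) (f g : R -> R) :
  (leb R).-integrable `[a, b] (EFin \o f) ->
  (leb R).-integrable `[a, b] (EFin \o g) ->
  (forall t, t \in `[a, b] -> 0 <= f t) ->
  (forall t, t \in `[a, b] -> 0 <= g t) ->
  (forall x y, x \in `[a, b] -> y \in `[a, b] -> x <= y ->
    (\int[leb R]_(t in `]x, y]) (f t)%:E <=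
     \int[leb R]_(t in `]x, y]) (g t)%:E)%E) ->
  {ae leb R, forall t, t \in `[a, b] -> f t <= g t}.
Proof.
move=> iF iG f0 g0 fg.
have mab := completed_measurable_itv _ `[a, b].
have restr0 (h : R -> R) : (forall t, t \in `[a, b] -> 0 <= h t) ->
    forall t, 0 <= (h \_ `[a, b]%classic) t.
  by move=> h0 t; rewrite patchE; case: ifPn => //; rewrite inE; exact: h0.
have restri (h : R -> R) : (leb R).-integrable `[a, b] (EFin \o h) ->
    (leb R).-integrable setT (EFin \o (h \_ `[a, b]%classic)).
  by move=> ih; rewrite -restrict_EFin; apply/(integrable_mkcond _ mab).1.
have mes (h : R -> R) : (leb R).-integrable `[a, b] (EFin \o h) ->
   @measurable_fun _ _ (lebT R) _ setT (EFin \o (h \_ `[a, b]%classic)).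
  by move=> /restri /measurable_int.
suff : {ae leb R, forall t, t \in `[a, b] ->
     (f \_ `[a, b]%classic) t <= (g \_ `[a, b]%classic) t}.
  apply: negligibleS => t /=; apply: contra_not => H tab; have := H tab.
  by rewrite !patchE mem_set.
apply: ae_le_of_integral; [exact: restri|exact: restri|].
apply: le_integral_borel; [|exact: restri|exact: restr0|exact: restr0|].
  by apply/measurable_EFinP; exact: mes.
apply: le_integral_open; [exact: mes|exact: mes| | |].
- by move=> t; rewrite lee_fin; exact: restr0.
- by move=> t; rewrite lee_fin; exact: restr0.
move=> J iJ.
have JE (h : R -> R) : (\int[leb R]_(t in J) ((h \_ `[a, b]%classic) t)%:E =
    \int[leb R]_(t in J `&` `[a, b]%classic) ((h \_ `[a, b]%classic) t)%:E)%E.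
  rewrite integral_mkcondr; congr integral; apply/funext => t.
  by rewrite !patchE; case: ifPn.
rewrite (JE f) (JE g).
have [->|/set0P K0] := eqVneq (J `&` `[a, b]%classic) set0.
  by rewrite !integral_set0.
set K := J `&` `[a, b]%classic in K0 *.
have iK : is_interval K.
  move=> u v [Ju uab] [Jv vab] w uwv; split; first exact: iJ uwv.
  exact: (@interval_is_interval _ _ u v).
have lK : has_lbound K by exists a => t [_]; rewrite /= in_itv => /andP[].
have uK : has_ubound K by exists b => t [_]; rewrite /= in_itv => /andP[].
have aK : a <= inf K.
  by apply: lb_le_inf => // t [_]; rewrite /= in_itv => /andP[].
have bK : sup K <= b.
  by apply: ge_sup => // t [_]; rewrite /= in_itv => /andP[].
(* [K] is nonempty and bounded: its infimum and supremum are its endpoints. *)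
have infsup : inf K <= sup K.
  case: K0 => t Kt; apply: (@le_trans _ _ t).
    exact: ge_inf.
  exact: ub_le_sup.
have -> : K = [set` Interval (BSide `[< K (inf K) >] (inf K))
                             (BSide (~~ `[< K (sup K) >]) (sup K))].
  by have := (is_intervalP K).1 iK; rewrite /Rhull (asboolT lK) (asboolT uK).
have hE (h : R -> R) : (leb R).-integrable `[a, b] (EFin \o h) ->
    (forall t, t \in `[a, b] -> 0 <= h t) -> forall c d,
    (\int[leb R]_(t in [set` Interval (BSide c (inf K)) (BSide d (sup K))])
       ((h \_ `[a, b]%classic) t)%:E =
     \int[leb R]_(t in `]inf K, sup K]) (h t)%:E)%E.
  move=> ih h0 c d; rewrite ge0_integral_itv; last 2 first.
  - exact: mes.
  - by move=> t; rewrite lee_fin; exact: restr0.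
  apply: eq_integral => t; rewrite inE/= in_itv/= => /andP[t1 t2]/=.
  rewrite patchE mem_set//= in_itv/= (le_trans aK (ltW t1)).
  exact: le_trans t2 bK.
rewrite (hE f)// (hE g)//.
by apply: fg; rewrite // in_itv/= ?aK ?bK ?andbT
  (le_trans _ infsup, le_trans infsup).
Qed.

(** * Functions in Lp *)

Lemma measurable_norm_powR d (T : measurableType d) (R : realType) (p : R)
    (h : T -> R) :
  measurable_fun setT h -> measurable_fun setT (fun t => (`|h t| `^ p)%:E).
Proof.
move=> mh; apply/measurable_EFinP.
apply: (@measurableT_comp _ _ _ _ _ _ (@powR R ^~ p)) => //.
exact: measurableT_comp.
Qed.

(** The outer power [p^-1] in the norm does not affect finiteness. *)
Lemma Lp_onP (R : realType) (p a b : R) (f : R -> R) : 0 < p ->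
  Lp_on p a b f <->
  @measurable_fun _ _ (lebT R) _ setT (f \_ `[a, b]%classic) /\
  (\int[leb R]_t (`|(f \_ `[a, b]%classic) t| `^ p)%:E < +oo)%E.
Proof.
move=> p0; have -> : Lp_on p a b f =
  ((f \_ `[a, b]%classic : lebT R -> R) \in Lfun (leb R) p%:E) by [].
rewrite inE /=; split.
- move=> /andP[/set_mem mf /set_mem]; rewrite /= /finite_norm => Nf; split => //.
  by have := poweR_lty p Nf; rewrite powR_Lnorm ?gt_eqF.
- move=> [mf intf]; apply/andP; split; apply/mem_set => //=.
  by rewrite /finite_norm unlock; exact: poweR_lty.
Qed.

(** On a set of finite measure, [|h| <= 1 + |h| ^ p] bounds the integral of
    [|h|]. *)
Lemma integrable_of_powR d (T : measurableType d) (R : realType)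
    (mu : {measure set T -> \bar R}) (D : set T) (p : R) (h : T -> R) :
  1 <= p -> measurable D -> (mu D < +oo)%E -> measurable_fun setT h ->
  (\int[mu]_t (`|h t| `^ p)%:E < +oo)%E -> mu.-integrable D (EFin \o h).
Proof.
move=> p1 mD Dfin mh ih.
have mhp := measurable_norm_powR _ _ _ p _ mh.
have mhpD : measurable_fun D (fun t => (`|h t| `^ p)%:E) := measurable_funTS mhp.
have hp0 t : (0 <= (`|h t| `^ p)%:E)%E by rewrite lee_fin powR_ge0.
have mhD : measurable_fun D (EFin \o h).
  by apply/measurable_EFinP; exact: measurable_funTS.
apply/integrableP; split => //.
apply: (@le_lt_trans _ _ (\int[mu]_(t in D) (1 + (`|h t| `^ p)%:E))%E).
  apply: ge0_le_integral => //.
  - exact: measurableT_comp.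
  - exact: emeasurable_funD.
  - move=> t tD; rewrite /= -EFinD lee_fin.
    have [h1|h1] := leP `|h t| 1; first by rewrite (le_trans h1)// lerDl powR_ge0.
    rewrite (@le_trans _ _ (`|h t| `^ p))//; last by rewrite lerDr.
    by rewrite -[leLHS]powRr1// ler_powR// ltW.
rewrite ge0_integralD// lte_add_pinfty//.
  by rewrite integral_cst// mul1e.
by apply: le_lt_trans ih; apply: ge0_subset_integral.
Qed.

Lemma Lp_on_summable (R : realType) (p a b : R) (g : R -> R) : 1 <= p ->
  Lp_on p a b g -> summable_on a b g.
Proof.
move=> p1 /(Lp_onP _ _ _ _ _ (lt_le_trans ltr01 p1))[mg ig].
have mab := completed_measurable_itv _ `[a, b].
apply: (@eq_integrable _ _ _ _ _ mab (EFin \o (g \_ `[a, b]%classic))).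
  by move=> t tab; rewrite /= patchE tab.
apply: (integrable_of_powR _ _ _ _ _ _ _ p1 mab _ mg ig).
have := completed_measureE _ `[a, b]; rewrite lebesgue_measure_itv/= => abE.
by rewrite [X in (X < _)%E]abE; case: ifP; rewrite -?EFinB ltry.
Qed.

Lemma integral_powR_lty_ae_le d (T : measurableType d) (R : realType)
    (mu : {measure set T -> \bar R}) (p : R) (h k : T -> R) :
  0 <= p -> measurable_fun setT h -> measurable_fun setT k ->
  {ae mu, forall t, `|h t| <= `|k t|} ->
  (\int[mu]_t (`|k t| `^ p)%:E < +oo -> \int[mu]_t (`|h t| `^ p)%:E < +oo)%E.
Proof.
move=> p0 mh mk hk; apply: le_lt_trans.
apply: ae_ge0_le_integral => //.
- exact: measurable_norm_powR.
- exact: measurable_norm_powR.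
apply: negligibleS hk => t /=; apply: contra_not => H _.
by rewrite lee_fin ge0_ler_powR ?nnegrE.
Qed.

Lemma Lp_on_le (R : realType) (p a b : R) (f g : R -> R) : 1 <= p ->
  summable_on a b f ->
  (forall x, x \in `[a, b] -> 0 <= f x) ->
  {ae leb R, forall t, t \in `[a, b] -> f t <= g t} ->
  Lp_on p a b g -> Lp_on p a b f.
Proof.
move=> p1 sf f0 fg; have p0 := lt_le_trans ltr01 p1.
move=> /(Lp_onP _ _ _ _ _ p0)[mg ig]; apply/(Lp_onP _ _ _ _ _ p0).
have mab := completed_measurable_itv _ `[a, b].
have mf : @measurable_fun _ _ (lebT R) _ setT (f \_ `[a, b]%classic).
  apply/(measurable_restrictT _ mab)/measurable_EFinP.
  exact: measurable_int sf.
split; first exact: mf.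
apply: (integral_powR_lty_ae_le _ _ _ _ _ _ _ (ltW p0) mf mg _ ig).
apply: negligibleS fg => t /=; apply: contra_not => H.
rewrite !patchE; case: ifPn => //; rewrite inE => tab.
by rewrite !ger0_norm ?H ?f0// (le_trans (f0 _ tab) (H tab)).
Qed.

(** * Convergence over subintervals *)

(** The integral over []x, y]] is the difference of those over [[a, y]] and
    [[a, x]]. *)
Lemma cvg_integral_itvoc (R : realType) (a b : R) (fn : nat -> R -> R)
    (f : R -> R) :
  (forall n, summable_on a b (fn n)) -> summable_on a b f ->
  (forall x, x \in `[a, b] ->
    (\int[leb R]_(t in `[a, x]) fn n t) @[n --> \oo] -->
      \int[leb R]_(t in `[a, x]) f t) ->
  forall x y, x \in `[a, b] -> y \in `[a, b] -> x <= y ->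
  (\int[leb R]_(t in `]x, y]) fn n t) @[n --> \oo] -->
      \int[leb R]_(t in `]x, y]) f t.
Proof.
move=> sfn sf cv x y xab yab xy.
have mI := @completed_measurable_itv R.
have split_int (h : R -> R) : summable_on a b h ->
   \int[leb R]_(t in `]x, y]) h t =
   \int[leb R]_(t in `[a, y]) h t - \int[leb R]_(t in `[a, x]) h t.
  move=> sh.
  have ax : a <= x by move: xab; rewrite in_itv => /andP[].
  have yb : y <= b by move: yab; rewrite in_itv => /andP[].
  have E : `[a, y]%classic = `[a, x] `|` `]x, y].
    by rewrite -itv_bndbnd_setU.
  rewrite E Rintegral_setU//=.
  - by rewrite addrC addKr.
  - rewrite -E; apply: integrableS sh => //.
    by apply: subset_itvl; rewrite bnd_simp.
  - rewrite disj_set2E; apply/eqP; rewrite -subset0 => t [] /=.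
    by rewrite !in_itv/= => /andP[_ tx] /andP[]; rewrite ltNge tx.
rewrite split_int//; under eq_fun do rewrite split_int//.
by apply: cvgB; exact: cv.
Qed.

Theorem theorem1p2 (R : realType) (a b p : R) (fn : nat -> R -> R)
    (f g : R -> R) :
  a < b ->
  1 <= p ->
  (forall n x, x \in `[a, b] -> 0 <= fn n x) ->
  (forall n, summable_on a b (fn n)) ->
  (forall x, x \in `[a, b] -> 0 <= f x) ->
  summable_on a b f ->
  (forall x, x \in `[a, b] ->
    (\int[leb R]_(t in `[a, x]) fn n t) @[n --> \oo] -->
      \int[leb R]_(t in `[a, x]) f t) ->
  (forall x, x \in `[a, b] -> 0 < g x) ->
  Lp_on p a b g ->
  (forall n, {ae leb R, forall t, t \in `[a, b] -> fn n t <= g t}) ->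
  Lp_on p a b f.
Proof.
move=> _ p1 fn0 sfn f0 sf cv g0 Lg fng.
have sg := Lp_on_summable _ _ _ _ _ p1 Lg.
apply: (Lp_on_le _ _ _ _ _ _ p1 sf f0 _ Lg).
apply: (ae_le_of_integral_itv _ _ _ _ _ sf sg f0) => [t /g0/ltW//|x y xab yab xy].
have mxy := completed_measurable_itv _ `]x, y].
have sub : `]x, y]%classic `<=` `[a, b]%classic.
  move: xab yab; rewrite !in_itv/= => /andP[ax _] /andP[_ yb].
  by apply: subset_itv; rewrite bnd_simp.
have mab := completed_measurable_itv _ `[a, b].
have ixy (h : R -> R) : summable_on a b h ->
    (leb R).-integrable `]x, y] (EFin \o h).
  by move=> sh; exact: integrableS sh.
have mxyE (h : R -> R) : summable_on a b h ->
    @measurable_fun _ _ (lebT R) _ `]x, y]%classic (EFin \o h).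
  by move=> /ixy/measurable_int.
suff : \int[leb R]_(t in `]x, y]) f t <= \int[leb R]_(t in `]x, y]) g t.
  by rewrite -lee_fin /Rintegral !fineK//;
    apply: integrable_fin_num => //; exact: ixy.
have cvxy := cvg_integral_itvoc _ _ _ _ _ sfn sf cv _ _ xab yab xy.
apply: (ler_cvg_to cvxy (cvg_cst _)).
apply: nearW => n.
rewrite /Rintegral fine_le//; do ?[apply: integrable_fin_num => //; exact: ixy].
apply: (ae_ge0_le_integral mxy _ (mxyE _ (sfn n)) _ (mxyE _ sg)).
- by move=> t /sub tab; rewrite lee_fin fn0.
- by move=> t /sub tab; rewrite lee_fin ltW// g0.
apply: negligibleS (fng n) => t /=; apply: contra_not => H /sub tab.
by rewrite lee_fin H.
Qed.
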